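(* Let $\mathbb{T}$ be the $m$-regular tree, let $L$ be the averaging operator with parameter $\beta\in[0,1]$, and let $h:\mathbb{T}\to\mathbb{R}$. Then for every continuous $f:[0,1]\to\mathbb{R}$ there exists a unique bounded function $u:\mathbb{T}\to\mathbb{R}$ with $L(u)(x)=h(x)$ for all $x\in\mathbb{T}$ and $u|_{\partial\mathbb{T}}=f$, if and only if: $0\le\beta<\tfrac12$, the series defining $S^\beta_h(x)$ converges for every $x\in\mathbb{T}$, and $$\lim_{k\to\infty}\ \sup_{x\in\mathbb{T},\,|x|=k}\ \Big|\sum_{j=1}^{k}\Big(\frac{\beta}{1-\beta}\Big)^{k-j}S^\beta_h(x^j)\Big|=0 .$$
   Context: The $m$-regular tree $\mathbb{T}$ ($m\ge 2$): its nodes are the root $\emptyset$ and all finite tuples $x=(a_1,\dots,a_k)$ with $a_i\in\{0,\dots,m-1\}$; $|x|=k$ is the level of $x$. For $x\neq\emptyset$, $\hat x$ denotes its predecessor. $S^l(x)$ is the set of the $m^l$ successors of $x$ at level $|x|+l$, $S^0(x)=\{x\}$. For $|x|=k$ and $1\le j\le k$, $x^j$ is the predecessor of $x$ at level $j$ ($x^k=x$). A branch $z$ is an infinite sequence $(a_1,a_2,\dots)$ with nodes $z_n=(a_1,\dots,a_n)$; $\partial\mathbb{T}$ is the set of branches, $\psi(z)=\sum_{k\ge1}a_k m^{-k}$; $z$ passes through $x$ if $x=z_{|x|}$. Averaging operator: $L(u)(x)=u(x)-\beta u(\hat x)-(1-\beta)\frac1m\sum_{y\in S^1(x)}u(y)$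 for $x\ne\emptyset$, $L(u)(\emptyset)=u(\emptyset)-\frac1m\sum_{y\in S^1(\emptyset)}u(y)$. $u|_{\partial\mathbb{T}}=f$ means: for every $\varepsilon>0$ there is $K$ such that $|u(x)-f(\psi(z))|<\varepsilon$ for all nodes $x$ with $|x|\ge K$ and all branches $z$ through $x$. For $\beta\in[0,1)$, $S^\beta_h(x)=\sum_{i=1}^\infty\sum_{j=0}^{i-1}\frac{\beta^{i-j-1}}{(1-\beta)^{i-j}}\frac{1}{m^j}\sum_{y\in S^j(x)}h(y)$ (equal to $\frac1\beta\sum_{i\ge1}\sum_{j=0}^{i-1}(\frac{\beta}{1-\beta})^{i-j}m^{-j}\sum_{y\in S^j(x)}h(y)$ when $\beta>0$); convention $0^0=1$. *)

(* Defs.v *)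
From mathcomp Require Import all_boot all_order all_algebra.
From mathcomp Require Import all_classical all_reals all_analysis.
Import Order.TTheory GRing.Theory Num.Theory.
Import numFieldNormedType.Exports.
Local Open Scope ring_scope.

(* Nodes of the m-regular tree: finite sequences over 'I_m = {0,..,m-1};
   the level |x| is [size x]; the root is [::]. *)

Definition pred_node {m : nat} (x : seq 'I_m) : seq 'I_m := take (size x).-1 x.

Definition anc {m : nat} (x : seq 'I_m) (j : nat) : seq 'I_m := take j x.

Definition avg_succ {R : realType} {m : nat} (u : seq 'I_m -> R) (j : nat)
  (x : seq 'I_m) : R :=
  (m%:R ^+ j)^-1 * \sum_(s : j.-tuple 'I_m) u (x ++ s).

Definition Lop {R : realType} {m : nat} (beta : R) (u : seq 'I_m -> R)
  (x : seq 'I_m) : R :=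
  if x is [::] then u x - avg_succ u 1 x
  else u x - beta * u (pred_node x) - (1 - beta) * avg_succ u 1 x.

Definition S_term {R : realType} {m : nat} (beta : R) (h : seq 'I_m -> R)
  (x : seq 'I_m) (i : nat) : R :=
  \sum_(j < i) (beta ^+ (i - j - 1) / (1 - beta) ^+ (i - j)) * avg_succ h j x.

Definition S_partial {R : realType} {m : nat} (beta : R) (h : seq 'I_m -> R)
  (x : seq 'I_m) : R ^nat :=
  series (fun i => S_term beta h x i.+1).

Definition S_converges {R : realType} {m : nat} (beta : R) (h : seq 'I_m -> R)
  (x : seq 'I_m) : Prop := cvgn (S_partial beta h x).

Definition S_beta {R : realType} {m : nat} (beta : R) (h : seq 'I_m -> R)
  (x : seq 'I_m) : R := limn (S_partial beta h x).

(* Branches: z : nat -> 'I_m encodes (a_1, a_2, ...) with a_k = z (k-1).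
   z passes through x iff x = z_{|x|} = (a_1,...,a_{|x|}). *)
Definition passes_through {m : nat} (z : nat -> 'I_m) (x : seq 'I_m) : Prop :=
  x = [seq z i | i <- iota 0 (size x)].

Definition psi {R : realType} {m : nat} (z : nat -> 'I_m) : R :=
  limn (series (fun k => (nat_of_ord (z k))%:R / (m%:R ^+ k.+1) : R)).

Definition boundary_value {R : realType} {m : nat} (u : seq 'I_m -> R)
  (f : R -> R) : Prop :=
  forall eps : R, 0 < eps -> exists K : nat,
    forall x : seq 'I_m, (K <= size x)%N ->
    forall z : nat -> 'I_m, passes_through z x ->
      `| u x - f (psi z) | < eps.

Definition tree_bounded {R : realType} {m : nat} (u : seq 'I_m -> R) : Prop :=
  exists M : R, forall x, `| u x | <= M.

(* sup_{|x| = k} | sum_{j=1}^k (beta/(1-beta))^{k-j} S^beta_h(x^j) |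
   (a finite sup of nonnegative numbers over the m^k nodes of level k) *)
Definition level_sup {R : realType} {m : nat} (beta : R) (h : seq 'I_m -> R)
  (k : nat) : R :=
  \big[Num.max/0]_(t : k.-tuple 'I_m)
     `| \sum_(1 <= j < k.+1)
          (beta / (1 - beta)) ^+ (k - j) * S_beta beta h (anc (tval t) j) |.

(* Main.v *)
Require Import Defs.
From mathcomp Require Import all_boot all_order all_algebra.
From mathcomp Require Import all_classical all_reals all_analysis.
From mathcomp Require Import ring lra zify.
Import Order.TTheory GRing.Theory Num.Theory.
Import numFieldNormedType.Exports.
Local Open Scope classical_set_scope.
Local Open Scope ring_scope.

(** Write [r = beta / (1 - beta)] and [A] for the average over the children. For a
    solution [u] of [L u = h] the increments [d x = u x - u (pred x)] satisfy
    [A d = r d - h / (1 - beta)]; iterating and summing over the levels below [x] gives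
    [A^n u x - u x = (r + ... + r^n) d x - S_n x], with [S_n] the partial sums of
    [S_h^beta]. If [r >= 1] and [h = 0], boundedness forces [d = 0], so [u] is
    constant and cannot have boundary value [id]. If [r < 1], let [F x] be the limit
    of [A^n u x], the average of [f] below [x]; letting [n] grow yields
    [u x = r u (pred x) + (1 - r) (F x + S x)]. This determines [u], and conversely
    defines a solution because [A F = F] and [A S = S - h / (1 - 2 beta)]. Unrolling
    the recursion, [u - F] vanishes at the boundary exactly when the weighted sums of
    [S] along ancestors do. *)

Definition avg {R : realType} {m : nat} (u : seq 'I_m -> R) (x : seq 'I_m) : R :=
  m%:R^-1 * \sum_(a < m) u (rcons x a).

Lemma sum_tupleS {R : realType} {m : nat} n (F : seq 'I_m -> R) :
  \sum_(s : n.+1.-tuple 'I_m) F s =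
  \sum_(a < m) \sum_(s : n.-tuple 'I_m) F (a :: s).
Proof.
rewrite pair_big /=.
rewrite (reindex (fun p : 'I_m * n.-tuple 'I_m => cons_tuple p.1 p.2)) //=.
exists (fun t => (thead t, [tuple of behead t])) => [[a s] _|t _] /=.
  by congr pair; apply: val_inj.
by rewrite [RHS]tuple_eta; apply: val_inj.
Qed.

Lemma avg_succE {R : realType} {m : nat} (u : seq 'I_m -> R) n x :
  avg_succ u n x = iter n avg u x.
Proof.
rewrite /avg_succ; elim: n u x => [|n IH] u x.
  rewrite expr0 invr1 mul1r (big_pred1 [tuple]) ?cats0 // => t.
  by apply/esym/eqP/val_inj => /=; case: t => -[].
rewrite (sum_tupleS n (fun s => u (x ++ s))) /= /avg exprS invfM -mulrA mulr_sumr.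
congr (_ * _); apply: eq_bigr => a _; rewrite -IH; congr (_ * _).
by apply: eq_bigr => s _; rewrite cat_rcons.
Qed.

Lemma avgD {R : realType} {m : nat} (u v : seq 'I_m -> R) x :
  avg (fun y => u y + v y) x = avg u x + avg v x.
Proof. by rewrite /avg big_split mulrDr. Qed.

Lemma avgZ {R : realType} {m : nat} c (u : seq 'I_m -> R) x :
  avg (fun y => c * u y) x = c * avg u x.
Proof. by rewrite /avg -mulr_sumr mulrCA. Qed.

Lemma avgB {R : realType} {m : nat} (u v : seq 'I_m -> R) x :
  avg (fun y => u y - v y) x = avg u x - avg v x.
Proof. by rewrite /avg sumrB mulrBr. Qed.

Lemma avg_const {R : realType} {m : nat} (c : R) (x : seq 'I_m) :
  (0 < m)%N -> avg (fun=> c) x = c.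
Proof.
move=> m0; rewrite /avg sumr_const card_ord -[c *+ m]mulr_natl mulrA mulVf ?mul1r //.
by rewrite pnatr_eq0 -lt0n.
Qed.

Lemma iter_avgB {R : realType} {m : nat} n (u v : seq 'I_m -> R) x :
  iter n avg (fun y => u y - v y) x = iter n avg u x - iter n avg v x.
Proof.
elim: n x => [//|n IH] x /=; rewrite -avgB.
by congr (avg _ x); apply/funext => y.
Qed.

Lemma avg_bound {R : realType} {m : nat} (u : seq 'I_m -> R) (c : R) x :
  (0 < m)%N -> (forall a, `|u (rcons x a)| <= c) -> `|avg u x| <= c.
Proof.
move=> m0 uc; rewrite -[c](@avg_const R m c x m0) /avg normrM ger0_norm; last first.
  by rewrite invr_ge0 ler0n.
rewrite ler_wpM2l ?invr_ge0 ?ler0n //.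
by apply: le_trans (ler_norm_sum _ _ _) _; apply: ler_sum => a _.
Qed.

Lemma iter_avg_bound {R : realType} {m : nat} n (u : seq 'I_m -> R) (c : R) x :
  (0 < m)%N -> (forall s, size s = n -> `|u (x ++ s)| <= c) ->
  `|iter n avg u x| <= c.
Proof.
move=> m0; elim: n x => [|n IH] x uc /=; first by rewrite -[x]cats0; exact: uc.
apply: avg_bound => // a; apply: IH => s sn; rewrite cat_rcons.
by apply: uc; rewrite /= sn.
Qed.

Lemma iter_avg_const {R : realType} {m : nat} n (c : R) (x : seq 'I_m) :
  (0 < m)%N -> iter n avg (fun=> c) x = c.
Proof.
move=> m0; elim: n x => [//|n IH] x /=.
by rewrite (_ : iter n avg _ = fun=> c) ?avg_const //; apply/funext.
Qed.

Lemma cvg_avg {R : realType} {m : nat} (u : nat -> seq 'I_m -> R)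
    (v : seq 'I_m -> R) x :
  (forall y, u n y @[n --> \oo] --> v y) ->
  avg (u n) x @[n --> \oo] --> avg v x.
Proof.
move=> uv; apply: cvgM; first exact: cvg_cst.
elim: (index_enum _) => [|a s IH].
  by under eq_fun do rewrite big_nil; rewrite big_nil; exact: cvg_cst.
under eq_fun do rewrite big_cons; rewrite big_cons.
by apply: cvgD => //; exact: uv.
Qed.

Lemma LopE {R : realType} {m : nat} (beta : R) (u : seq 'I_m -> R) x :
  Lop beta u x = if x is [::] then u x - avg u x
  else u x - beta * u (pred_node x) - (1 - beta) * avg u x.
Proof. by case: x => [|a x] /=; rewrite avg_succE. Qed.

Lemma pred_node_rcons {m : nat} (x : seq 'I_m) a : pred_node (rcons x a) = x.
Proof. by rewrite /pred_node size_rcons /= -cats1 take_size_cat. Qed.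

(* At the root the increment is chosen so that [avg_incr] also holds there. *)
Definition incr {R : realType} {m : nat} (u h : seq 'I_m -> R) (x : seq 'I_m) : R :=
  if x is [::] then h x else u x - u (pred_node x).

Lemma avg_incr_sub {R : realType} {m : nat} (u h : seq 'I_m -> R) x :
  (0 < m)%N -> avg (incr u h) x = avg u x - u x.
Proof.
move=> m0; rewrite -[X in _ - X](@avg_const R m (u x) x m0) -avgB /avg.
congr (_ * _); apply: eq_bigr => a _; rewrite /incr.
by case: x => [|b x] //=; rewrite -[b :: rcons x a]/(rcons (b :: x) a) pred_node_rcons.
Qed.

Lemma avg_incr {R : realType} {m : nat} (beta : R) (u h : seq 'I_m -> R) x :
  (0 < m)%N -> beta < 1 -> (forall y, Lop beta u y = h y) ->
  avg (incr u h) x = beta / (1 - beta) * incr u h x - h x / (1 - beta).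
Proof.
move=> m0 b1 Lu; rewrite avg_incr_sub //; have := Lu x.
have nz : 1 - beta != 0 by rewrite subr_eq0 gt_eqF.
rewrite LopE /incr; case: x => [|a x] <-; by field.
Qed.

Lemma S_termS {R : realType} {m : nat} (beta : R) (h : seq 'I_m -> R) x n :
  beta < 1 -> S_term beta h x n.+1 =
  beta / (1 - beta) * S_term beta h x n + iter n avg h x / (1 - beta).
Proof.
move=> b1; have nz : 1 - beta != 0 by rewrite subr_eq0 gt_eqF.
rewrite /S_term big_ord_recr /= avg_succE subSnn subnn expr0 expr1 mul1r.
congr (_ + _); last by rewrite mulrC.
rewrite mulr_sumr; apply: eq_bigr => j _.
have -> : (n.+1 - j - 1 = (n - j - 1).+1)%N by have := ltn_ord j; lia.
have -> : (n.+1 - j = (n - j).+1)%N by have := ltn_ord j; lia.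
by rewrite !exprS; field; rewrite expf_neq0 // nz.
Qed.

Lemma S_termS_avg {R : realType} {m : nat} (beta : R) (h : seq 'I_m -> R) x n :
  beta < 1 -> S_term beta h x n.+1 =
  avg (fun y => S_term beta h y n) x + (beta / (1 - beta)) ^+ n * (h x / (1 - beta)).
Proof.
move=> b1; have nz : 1 - beta != 0 by rewrite subr_eq0 gt_eqF.
elim: n => [|n IH].
  rewrite S_termS //= /S_term big_ord0 mulr0 add0r expr0 mul1r.
  by rewrite /avg big1 ?mulr0 ?add0r // => a _; rewrite big_ord0.
rewrite S_termS // IH /= exprS.
under [in RHS]eq_fun do rewrite S_termS //.
rewrite avgD avgZ.
under [X in _ = _ + avg X x + _]eq_fun do rewrite mulrC.
by rewrite avgZ; ring.
Qed.

Lemma iter_avg_incr {R : realType} {m : nat} (beta : R) (u h : seq 'I_m -> R) x n :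
  (0 < m)%N -> beta < 1 -> (forall y, Lop beta u y = h y) ->
  iter n avg (incr u h) x = (beta / (1 - beta)) ^+ n * incr u h x - S_term beta h x n.
Proof.
move=> m0 b1 Lu; elim: n x => [|n IH] x.
  by rewrite /S_term big_ord0 expr0 mul1r subr0.
rewrite /= S_termS_avg //.
have -> : iter n avg (incr u h) = fun y =>
  (beta / (1 - beta)) ^+ n * incr u h y - S_term beta h y n by apply/funext.
by rewrite avgB avgZ (avg_incr beta) // exprS; ring.
Qed.

Lemma iter_avg_sub {R : realType} {m : nat} (beta : R) (u h : seq 'I_m -> R) x n :
  (0 < m)%N -> beta < 1 -> (forall y, Lop beta u y = h y) ->
  iter n avg u x - u x =
  (\sum_(0 <= i < n) (beta / (1 - beta)) ^+ i.+1) * incr u h x - S_partial beta h x n.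
Proof.
move=> m0 b1 Lu; rewrite /S_partial /series /=; elim: n => [|n IH].
  by rewrite !big_geq //= subrr mul0r subrr.
rewrite !big_nat_recr //= mulrDl opprD addrACA -IH.
rewrite -(iter_avg_incr beta u h x n.+1) // iterSr.
have -> : avg (incr u h) = fun y => avg u y - u y.
  by apply/funext => y; exact: avg_incr_sub.
by rewrite iter_avgB -iterSr /=; ring.
Qed.

Definition vanishes {R : realType} {m : nat} (u : seq 'I_m -> R) : Prop :=
  forall eps : R, 0 < eps ->
    exists K, forall x, (K <= size x)%N -> `|u x| <= eps.

Lemma vanishesD {R : realType} {m : nat} (u v : seq 'I_m -> R) :
  vanishes u -> vanishes v -> vanishes (fun x => u x + v x).
Proof.
move=> u0 v0 e e0; have e20 : 0 < e / 2 by lra.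
have [K1 H1] := u0 _ e20; have [K2 H2] := v0 _ e20.
exists (maxn K1 K2) => x; rewrite geq_max => /andP[/H1 h1 /H2 h2].
by apply: le_trans (ler_normD _ _) _; lra.
Qed.

Lemma vanishesZ {R : realType} {m : nat} c (u : seq 'I_m -> R) :
  vanishes u -> vanishes (fun x => c * u x).
Proof.
move=> u0 e e0; have c0 : 0 < `|c| + 1 by have := normr_ge0 c; lra.
have [K H] := u0 (e / (`|c| + 1)) ltac:(exact: divr_gt0).
exists K => x /H; rewrite ler_pdivlMr // normrM => ux.
by apply: le_trans ux; rewrite mulrDr mulr1 mulrC lerDl.
Qed.

Lemma level_bound {R : realType} {m : nat} (u : seq 'I_m -> R) n :
  exists M, forall x, size x = n -> `|u x| <= M.
Proof.
exists (\sum_(t : n.-tuple 'I_m) `|u t|) => x /eqP xn.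
rewrite (bigD1 (Tuple xn)) //= lerDl; exact: sumr_ge0.
Qed.

Lemma bounded_below_level {R : realType} {m : nat} (u : seq 'I_m -> R) K M :
  (forall x, (K <= size x)%N -> `|u x| <= M) -> tree_bounded u.
Proof.
elim: K M => [|K IH] M uM; first by exists M => x; exact: uM.
have [M' uM'] := level_bound u K.
apply: (IH (Num.max M M')) => x; rewrite leq_eqVlt le_max => /orP[/eqP xK|/uM ->//].
by rewrite uM' ?orbT.
Qed.

Lemma vanishes_contraction {R : realType} {m : nat} (r : R) (e d : seq 'I_m -> R) :
  0 <= r -> r < 1 -> vanishes d ->
  (forall x a, `|e (rcons x a)| <= r * `|e x| + `|d (rcons x a)|) -> vanishes e.
Proof.
move=> r0 r1 d0 ed eps eps0.
have [K HK] := d0 ((1 - r) * (eps / 2)) ltac:(apply: mulr_gt0; lra).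
have [M HM] := level_bound e K.
have bound n x : size x = (K + n)%N -> `|e x| <= r ^+ n * `|M| + eps / 2.
  elim: n x => [|n IH] x; rewrite ?addn0 ?addnS.
    by move=> /HM h; rewrite expr0 mul1r; have := ler_norm M; lra.
  case/lastP: x => [//|x a]; rewrite size_rcons => -[xn].
  apply: le_trans (ed x a) _.
  have hd : `|d (rcons x a)| <= (1 - r) * (eps / 2).
    by apply: HK; rewrite size_rcons xn; lia.
  have := ler_wpM2l r0 (IH _ xn); rewrite exprS; lra.
have : r ^+ n * `|M| @[n --> \oo] --> (0 * `|M| : R).
  by apply: cvgM; [apply: cvg_expr; rewrite ger0_norm|exact: cvg_cst].
rewrite mul0r => /cvgrPdist_le /(_ (eps / 2) ltac:(lra)) [N _ HN].
exists (K + N)%N => x Kx.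
have := HN (size x - K)%N ltac:(rewrite /=; lia).
rewrite sub0r normrN ger0_norm ?mulr_ge0 ?exprn_ge0 // => h.
have := bound (size x - K)%N x ltac:(lia); lra.
Qed.

Definition psi_series {R : realType} {m : nat} (z : nat -> 'I_m) : R ^nat :=
  series (fun k => (nat_of_ord (z k))%:R / (m%:R ^+ k.+1) : R).

Lemma psi_bounds {R : realType} {m : nat} (z : nat -> 'I_m) n :
  @psi_series R m z n <= @psi R m z <= @psi_series R m z n + m%:R ^- n.
Proof.
set s : R ^nat := psi_series z; have m0 : (0 < m)%N := leq_ltn_trans (leq0n _) (ltn_ord (z 0%N)).
have mR : 0 < m%:R :> R by rewrite ltr0n.
have step k : s k <= s k.+1 <= s k + (m%:R ^- k - m%:R ^- k.+1).
  have -> : s k.+1 = s k + (nat_of_ord (z k))%:R / (m%:R ^+ k.+1).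
    by rewrite /s /psi_series /series /= big_nat_recr.
  rewrite lerDl lerD2l divr_ge0 ?exprn_ge0 ?ler0n //=.
  have -> : m%:R ^- k - m%:R ^- k.+1 = (m%:R - 1) / m%:R ^+ k.+1 :> R.
    by rewrite exprS; field; rewrite expf_neq0 gt_eqF.
  rewrite ler_pM2r ?invr_gt0 ?exprn_gt0 //.
  have : ((z k).+1%:R <= m%:R :> R) by rewrite ler_nat ltn_ord.
  rewrite -natr1; lra.
have nd : {homo s : i j / (i <= j)%N >-> i <= j}.
  by apply/nondecreasing_seqP => k; case/andP: (step k).
have ub k p : s (k + p)%N <= s k + (m%:R ^- k - m%:R ^- (k + p)).
  elim: p => [|p IH]; first by rewrite addn0; lra.
  rewrite addnS; case/andP: (step (k + p)%N) => _; lra.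
have ub' k p : s p <= s k + m%:R ^- k.
  have V0 q : 0 < m%:R ^- q :> R by rewrite invr_gt0 exprn_gt0.
  case: (leqP k p) => [kp|/ltnW /nd pk].
    have := ub k (p - k)%N; rewrite subnKC // => h; have := V0 p; lra.
  have := V0 k; lra.
have cs : cvgn s.
  by apply: nondecreasing_is_cvgn => //; exists (s 0%N + m%:R ^- 0%N) => _ [p _ <-].
apply/andP; split; first exact: nondecreasing_cvgn_le.
by apply: limr_le => //; apply: nearW => p; exact: ub'.
Qed.

Lemma psi_itv {R : realType} {m : nat} (z : nat -> 'I_m) : psi z \in `[0 : R, 1].
Proof.
have := @psi_bounds R m z 0; rewrite /psi_series /series /= big_geq // expr0 invr1 add0r.
by rewrite in_itv.
Qed.

Lemma psi_close {R : realType} {m : nat} (z z' : nat -> 'I_m) n :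
  (forall i, (i < n)%N -> z i = z' i) ->
  `|psi z - psi z' : R| <= m%:R ^- n.
Proof.
move=> zz'; have := @psi_bounds R m z n; have := @psi_bounds R m z' n.
have -> : psi_series z n = psi_series z' n :> R.
  by rewrite /psi_series /series /= !big_nat; apply: eq_bigr => i /andP[_ /zz' ->].
move=> /= /andP[a b] /andP[c d]; rewrite ler_norml; apply/andP; split; lra.
Qed.

Lemma passes_through_nth {m : nat} (z : nat -> 'I_m) x i z0 :
  passes_through z x -> (i < size x)%N -> z i = nth z0 x i.
Proof.
move=> zx ix; rewrite zx (nth_map 0%N) ?size_iota // nth_iota //.
Qed.

Lemma nth_passes_through {m : nat} (z0 : 'I_m) x : passes_through (nth z0 x) x.
Proof. by apply/esym; rewrite -[RHS](mkseq_nth z0). Qed.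

Lemma segment_unif_continuous {R : realType} (f : R -> R) :
  {within `[0, 1]%classic, continuous f} ->
  forall e : R, 0 < e -> exists2 d : R, 0 < d &
    forall x y, x \in `[0, 1] -> y \in `[0, 1] -> `|x - y| < d -> `|f x - f y| <= e.
Proof.
move=> /subspace_continuousP cf e e0.
have cov : near_covering_within `[0 : R, 1]%classic.
  exact/near_covering_withinP/compact_near_coveringP/segment_compact.
have ev : \forall d \near (0 : R)^'+, `[0, 1]%classic `<=`
    (fun x => forall y, y \in `[0, 1] -> `|x - y| < d -> `|f x - f y| <= e).
  apply: (cov R _ (fun d x => forall y, y \in `[0, 1] -> `|x - y| < d ->
    `|f x - f y| <= e)).
  move=> x x01.
  have := cf x x01; move=> /cvgrPdist_le /(_ (e / 2) ltac:(lra)).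
  rewrite near_withinE /= => /nbhs_ballP [/= eta eta0 Heta].
  exists (ball x (eta / 2), [set d | 0 < d < eta / 2]).
    split; first by apply: nbhsx_ballx; rewrite divr_gt0.
    near=> d; apply/andP; split => //; near: d.
    by apply: nbhs_right_lt; rewrite divr_gt0.
  move=> [x' d] /= [xx' /andP[d0 deta]] x'01 y y01 xy.
  have h1 : `|f x - f x'| <= e / 2.
    by apply: Heta => //; apply: le_ball xx'; move: eta0 => /=; lra.
  have h2 : `|f x - f y| <= e / 2.
    apply: Heta => //; rewrite /ball /=; move: xx'; rewrite /ball /= => xx'.
    have := ler_normD (x - x') (x' - y); rewrite addrA subrK; lra.
  have := ler_normD (f x' - f x) (f x - f y).
  rewrite addrA subrK [ `|f x' - f x|]distrC; lra.
have [d [H d0]] := filter_ex (filterI ev (nbhs_right_gt 0)).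
exists d => // x y x01 y01; exact: H.
Unshelve. all: end_near. Qed.

(* Every node is continued to a branch by repeating the letter [z0]. *)
Definition bval {R : realType} {m : nat} (z0 : 'I_m) (f : R -> R) (x : seq 'I_m) : R :=
  f (psi (nth z0 x)).

Lemma branch_oscillation {R : realType} {m : nat} (f : R -> R) :
  (2 <= m)%N -> {within `[0, 1]%classic, continuous f} ->
  forall e : R, 0 < e -> exists K, forall (z z' : nat -> 'I_m),
    (forall i, (i < K)%N -> z i = z' i) -> `|f (psi z) - f (psi z')| <= e.
Proof.
move=> m2 cf e e0; have [d d0 Hd] := segment_unif_continuous f cf e e0.
have mR : 1 < m%:R :> R by rewrite ltr1n.
have : (m%:R^-1 : R) ^+ n @[n --> \oo] --> (0 : R).
  by apply: cvg_expr; rewrite ger0_norm ?invr_ge0 ?ler0n // invf_lt1 //; lra.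
move=> /cvgrPdist_lt /(_ d d0) [K _ /(_ K (leqnn K))] /=.
rewrite sub0r normrN exprVn ger0_norm ?invr_ge0 ?exprn_ge0 ?ler0n // => HK.
exists K => z z' zz'; apply: Hd; rewrite ?psi_itv //.
exact: le_lt_trans (@psi_close R m z z' K zz') HK.
Qed.

Lemma boundary_value_vanishes {R : realType} {m : nat} (z0 : 'I_m) (u : seq 'I_m -> R) (f : R -> R) :
  boundary_value u f -> vanishes (fun x => u x - bval z0 f x).
Proof.
move=> uf e e0; have [K HK] := uf e e0; exists K => x Kx.
by apply: ltW; apply: HK => //; exact: nth_passes_through.
Qed.

Lemma bval_oscillation {R : realType} {m : nat} (z0 : 'I_m) (f : R -> R) :
  (2 <= m)%N -> {within `[0, 1]%classic, continuous f} ->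
  forall e : R, 0 < e -> exists K, forall x s, (K <= size x)%N ->
    `|bval z0 f (x ++ s) - bval z0 f x| <= e.
Proof.
move=> m2 cf e e0; have [K HK] := branch_oscillation f m2 cf e e0.
exists K => x s Kx; apply: HK => i iK; rewrite nth_cat.
by rewrite (leq_trans iK Kx).
Qed.

Lemma vanishes_boundary_value {R : realType} {m : nat} (z0 : 'I_m) (u : seq 'I_m -> R) (f : R -> R) :
  (2 <= m)%N -> {within `[0, 1]%classic, continuous f} ->
  vanishes (fun x => u x - bval z0 f x) -> boundary_value u f.
Proof.
move=> m2 cf uf e e0; have e30 : 0 < e / 3 by lra.
have [K1 H1] := uf _ e30; have [K2 H2] := branch_oscillation f m2 cf _ e30.
exists (maxn K1 K2) => x; rewrite geq_max => /andP[/H1 h1 Kx] z zx.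
have h2 : `|bval z0 f x - f (psi z)| <= e / 3.
  apply: H2 => i iK; apply/esym; apply: passes_through_nth => //.
  exact: leq_trans iK Kx.
have := ler_normD (u x - bval z0 f x) (bval z0 f x - f (psi z)).
rewrite addrA subrK; lra.
Qed.

Lemma vanishes_bounded {R : realType} {m : nat} (z0 : 'I_m) (u : seq 'I_m -> R) (f : R -> R) :
  (2 <= m)%N -> {within `[0, 1]%classic, continuous f} ->
  vanishes (fun x => u x - bval z0 f x) -> tree_bounded u.
Proof.
move=> m2 cf uf; have [K1 H1] := uf 1 ltr01.
have [K2 H2] := bval_oscillation z0 f m2 cf 1 ltr01.
have [M HM] := level_bound (bval z0 f) K2.
apply: (@bounded_below_level R m u (maxn K1 K2) (2 + M)) => x.
rewrite geq_max => /andP[/H1 h1 Kx].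
have h2 := H2 (take K2 x) (drop K2 x); rewrite cat_take_drop size_takel // in h2.
have {}h2 := h2 (leqnn _); have h3 := HM (take K2 x) (size_takel Kx).
have := ler_normD (u x - bval z0 f x) (bval z0 f x); rewrite subrK.
have := ler_normD (bval z0 f x - bval z0 f (take K2 x)) (bval z0 f (take K2 x)).
rewrite subrK; lra.
Qed.

Lemma iter_avg_cvg0 {R : realType} {m : nat} (u : seq 'I_m -> R) x :
  (0 < m)%N -> vanishes u -> iter n avg u x @[n --> \oo] --> (0 : R).
Proof.
move=> m0 u0; apply/cvgrPdist_le => e e0; have [K HK] := u0 e e0.
exists K => // n /= Kn; rewrite sub0r normrN; apply: iter_avg_bound => // s sn.
by apply: HK; rewrite size_cat sn; lia.
Qed.

(* The average of [f] over the interval below [x], as a limit of level averages. *)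
Lemma harmonic_extension {R : realType} {m : nat} (z0 : 'I_m) (f : R -> R) :
  (2 <= m)%N -> {within `[0, 1]%classic, continuous f} ->
  exists F : seq 'I_m -> R, (forall x, avg F x = F x) /\
    vanishes (fun x => F x - bval z0 f x).
Proof.
move=> m2 cf; have m0 : (0 < m)%N by exact: ltnW.
pose g := bval z0 f.
have near_g e : 0 < e -> exists K, forall x n, (K <= size x)%N ->
    `|iter n avg g x - g x| <= e.
  move=> e0; have [K HK] := bval_oscillation z0 f m2 cf e e0; exists K => x n Kx.
  rewrite -[X in _ - X](@iter_avg_const R m n (g x) x m0) -iter_avgB.
  by apply: iter_avg_bound => // s _; exact: HK.
have cvg_g x : cvgn (fun n => iter n avg g x).
  apply/cauchy_cvgP/cauchy_exP => e e0.
  have [K HK] := near_g (e / 2) ltac:(lra).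
  exists (iter K avg g x); exists K => // n /= Kn.
  rewrite /ball /= -(subnKC Kn) iterD -iter_avgB.
  apply: (@le_lt_trans _ _ (e / 2)); last by lra.
  apply: iter_avg_bound => // s sK; rewrite distrC; apply: HK.
  by rewrite size_cat sK leq_addl.
exists (fun x => limn (fun n => iter n avg g x)); split=> [x|e e0].
  have h1 : iter n.+1 avg g x @[n --> \oo] --> limn (fun n => iter n avg g x).
    by have := cvg_g x; rewrite -(cvg_shiftS (fun n => iter n avg g x)).
  exact: cvg_unique (cvg_avg _ _ x cvg_g) h1.
have [K HK] := near_g e e0; exists K => x Kx.
have cg : `|iter n avg g x - g x| @[n --> \oo] -->
    `|limn (fun n => iter n avg g x) - g x|.
  by apply: cvg_norm; apply: cvgB; [exact: cvg_g|exact: cvg_cst].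
rewrite -(cvg_lim _ cg) //; apply: limr_le; first by apply/cvg_ex; eexists; exact: cg.
by apply: nearW => n; exact: HK.
Qed.

Lemma Lop_rcons {R : realType} {m : nat} (beta : R) (u : seq 'I_m -> R) x a :
  Lop beta u (rcons x a) =
  u (rcons x a) - beta * u x - (1 - beta) * avg u (rcons x a).
Proof.
rewrite LopE; have p := pred_node_rcons x a; case E: (rcons x a) p => [|b y] p; last by rewrite p.
by move: (size_rcons x a); rewrite E.
Qed.

Lemma incr_rcons {R : realType} {m : nat} (u h : seq 'I_m -> R) x a :
  incr u h (rcons x a) = u (rcons x a) - u x.
Proof.
rewrite /incr; have p := pred_node_rcons x a; case E: (rcons x a) p => [|b y] p; last by rewrite p.
by move: (size_rcons x a); rewrite E.
Qed.

Lemma LopB {R : realType} {m : nat} (beta : R) (u v : seq 'I_m -> R) x :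
  Lop beta (fun y => u y - v y) x = Lop beta u x - Lop beta v x.
Proof. by rewrite !LopE avgB; case: x => [|a x]; ring. Qed.

Lemma S_partial0 {R : realType} {m : nat} (beta : R) (x : seq 'I_m) n :
  (0 < m)%N -> S_partial beta (fun=> 0) x n = 0.
Proof.
move=> m0; rewrite /S_partial /series /= big1 // => i _.
by rewrite /S_term big1 // => j _; rewrite avg_succE iter_avg_const // mulr0.
Qed.

Lemma ratio_lt1 {R : realType} (beta : R) :
  0 <= beta -> beta < 1 / 2 -> 0 <= beta / (1 - beta) < 1.
Proof.
move=> b0 b1; apply/andP; split; first by apply: divr_ge0; lra.
by rewrite ltr_pdivrMr; lra.
Qed.

Lemma S_partial_cvg {R : realType} {m : nat} (beta : R) (u h : seq 'I_m -> R) x :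
  let r := beta / (1 - beta) in
  (0 < m)%N -> 0 <= beta -> beta < 1 / 2 -> (forall y, Lop beta u y = h y) ->
  vanishes u ->
  S_partial beta h x @ \oo --> r / (1 - r) * incr u h x + u x.
Proof.
move=> r m0 b0 b1 Lu u0; have /andP[r0 r1] := ratio_lt1 beta b0 b1.
have E n : S_partial beta h x n =
    series (geometric r r) n * incr u h x - (iter n avg u x - u x).
  rewrite (iter_avg_sub beta u h) //; last by lra.
  have -> : series (geometric r r) n = \sum_(0 <= i < n) r ^+ i.+1.
    by rewrite /series /=; apply: eq_bigr => i _; rewrite exprS.
  by rewrite /r; ring.
rewrite (funext E : S_partial beta h x = _).
rewrite (_ : _ + u x = r / (1 - r) * incr u h x - (0 - u x)); last by rewrite sub0r opprK.
apply: cvgB; last by apply: cvgB; [exact: iter_avg_cvg0|exact: cvg_cst].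
apply: cvgM; last exact: cvg_cst.
by apply: cvg_geometric_series; rewrite ger0_norm.
Qed.

Definition wsum {R : realType} {m : nat} (r : R) (S : seq 'I_m -> R) (x : seq 'I_m) : R :=
  \sum_(1 <= j < (size x).+1) r ^+ (size x - j) * S (anc x j).

Lemma wsum_nil {R : realType} {m : nat} (r : R) (S : seq 'I_m -> R) : wsum r S [::] = 0.
Proof. by rewrite /wsum big_geq. Qed.

Lemma wsum_rcons {R : realType} {m : nat} (r : R) (S : seq 'I_m -> R) x a :
  wsum r S (rcons x a) = r * wsum r S x + S (rcons x a).
Proof.
rewrite /wsum size_rcons big_nat_recr //= subnn expr0 mul1r.
congr (_ + _); last by rewrite /anc take_oversize // size_rcons.
rewrite mulr_sumr !big_nat; apply: eq_bigr => j /andP[j1 jx].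
rewrite subSn // exprS mulrA /anc -cats1 takel_cat //.
Qed.

Lemma level_sup_vanishes {R : realType} {m : nat} (beta : R) (h : seq 'I_m -> R) :
  level_sup beta h @ \oo --> (0 : R) <->
  vanishes (wsum (beta / (1 - beta)) (S_beta beta h)).
Proof.
split=> [/cvgrPdist_le H e e0|H].
  have [K _ HK] := H e e0; exists K => x Kx; apply: le_trans (HK _ Kx).
  rewrite sub0r normrN; apply: le_trans (ler_norm _).
  exact: (le_bigmax _ (fun t : (size x).-tuple 'I_m => `| \sum_(1 <= j < (size x).+1)
    (beta / (1 - beta)) ^+ (size x - j) * S_beta beta h (anc t j)|) (in_tuple x)).
apply/cvgrPdist_le => e e0; have [K HK] := H e e0; exists K => // k /= Kk.
rewrite sub0r normrN ger0_norm.
  apply: bigmax_le => [|t _]; first exact: ltW.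
  by have := HK t; rewrite /wsum size_tuple; exact.
exact: bigmax_ge_id.
Qed.

Lemma avg_S_beta {R : realType} {m : nat} (beta : R) (h : seq 'I_m -> R) x :
  0 <= beta -> beta < 1 / 2 -> (forall y, S_converges beta h y) ->
  avg (S_beta beta h) x = S_beta beta h x - h x / (1 - 2 * beta).
Proof.
move=> b0 b1 Sc; have /andP[r0 r1] := ratio_lt1 beta b0 b1.
set r := beta / (1 - beta) in r0 r1.
have E n : avg (fun y => S_partial beta h y n) x =
    S_partial beta h x n.+1 - series (geometric (h x / (1 - beta)) r) n.+1.
  rewrite /S_partial /series /=; elim: n => [|n IH].
    rewrite !big_nat1 S_termS_avg; last by lra.
    rewrite !expr0 mul1r mulr1 addrK /S_term.
    congr (_ * _); apply: eq_bigr => a _.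
    by rewrite big_geq // big_ord0.
  rewrite (big_nat_recr n.+1) // (big_nat_recr n.+1) //= opprD addrACA -IH.
  under eq_fun do rewrite big_nat_recr //=.
  rewrite avgD; congr (_ + _).
  by rewrite [in RHS]S_termS_avg; [rewrite /r; ring|lra].
have h1 : avg (fun y => S_partial beta h y n) x @[n --> \oo] --> avg (S_beta beta h) x.
  by apply: cvg_avg => y; exact: Sc.
have h2 : avg (fun y => S_partial beta h y n) x @[n --> \oo] -->
    S_beta beta h x - h x / (1 - beta) / (1 - r).
  rewrite (funext E); apply: cvgB.
    by have := Sc x; rewrite /S_converges -(cvg_shiftS (S_partial beta h x)).
  rewrite (cvg_shiftS (series _)); apply: cvg_geometric_series.
  by rewrite ger0_norm.
rewrite (cvg_unique _ h1 h2) //; congr (_ - _); rewrite /r; field.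
by do ?[apply/andP; split]; lra.
Qed.

Lemma Lop_eq0_vanishing {R : realType} {m : nat} (beta : R) (w : seq 'I_m -> R) :
  (0 < m)%N -> 0 <= beta -> beta < 1 / 2 -> (forall x, Lop beta w x = 0) ->
  vanishes w -> forall x, w x = 0.
Proof.
move=> m0 b0 b1 Lw w0; have /andP[r0 r1] := ratio_lt1 beta b0 b1.
set r := beta / (1 - beta) in r0 r1.
have H x : r / (1 - r) * incr w (fun=> 0) x + w x = 0.
  apply: cvg_unique (S_partial_cvg beta w (fun=> 0) x m0 b0 b1 Lw w0) _ => //.
  rewrite (_ : S_partial _ _ _ = fun=> 0); first exact: cvg_cst.
  by apply/funext => n; exact: S_partial0.
elim/last_ind => [|x a IH]; first by have := H [::]; rewrite /= mulr0 add0r.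
have := H (rcons x a); rewrite incr_rcons IH subr0 -[X in _ + X]mul1r -mulrDl.
move=> /eqP; rewrite mulf_eq0 => /orP[/eqP|/eqP//].
have : 0 <= r / (1 - r) by apply: divr_ge0; lra.
lra.
Qed.

Lemma S_conditions_of_vanishing_solution {R : realType} {m : nat} (beta : R) (u h : seq 'I_m -> R) :
  (0 < m)%N -> 0 <= beta -> beta < 1 / 2 -> (forall y, Lop beta u y = h y) ->
  vanishes u ->
  (forall x, S_converges beta h x) /\ level_sup beta h @ \oo --> (0 : R).
Proof.
move=> m0 b0 b1 Lu u0; have /andP[r0 r1] := ratio_lt1 beta b0 b1.
have Sl x := S_partial_cvg beta u h x m0 b0 b1 Lu u0.
set r := beta / (1 - beta) in r0 r1 Sl.
split=> [x|]; first by apply/cvg_ex; eexists; exact: Sl.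
apply/level_sup_vanishes; rewrite -/r; set W := wsum r _.
have SE x : S_beta beta h x = r / (1 - r) * incr u h x + u x by exact: cvg_lim (Sl x).
pose e x := (1 - r) * W x - u x.
have e0 : vanishes e.
  apply: (@vanishes_contraction R m r e (fun=> 0)) => // [eps eps0|x a].
    by exists 0%N => x _; rewrite normr0 ltW.
  rewrite normr0 addr0 -[X in X * _]ger0_norm // -normrM.
  rewrite (_ : e (rcons x a) = r * e x) //.
  rewrite /e /W wsum_rcons SE incr_rcons; field; lra.
have : vanishes (fun x => (1 - r)^-1 * (e x + u x)) by apply/vanishesZ/vanishesD.
congr vanishes; apply/funext => x; rewrite /e subrK mulKf //; lra.
Qed.

Lemma beta_lt_half {R : realType} {m : nat} (beta : R) (w : seq 'I_m -> R) :
  (2 <= m)%N -> 0 <= beta -> beta <= 1 -> (forall y, Lop beta w y = 0) ->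
  tree_bounded w -> boundary_value w id -> beta < 1 / 2.
Proof.
move=> m2 b0 b1 Lw [M wM] wid; have m0 : (0 < m)%N by exact: ltnW.
rewrite ltNge; apply/negP => b2.
have wS x a : w (rcons x a) = w x.
  have [b_lt1|b_ge1] := ltP beta 1; last first.
    by have := Lw (rcons x a); rewrite Lop_rcons (_ : beta = 1); [lra|lra].
  apply/eqP; rewrite -subr_eq0 -(incr_rcons w (fun=> 0)); set d := incr _ _ _.
  apply: contraT => d0; have {}d0 : 0 < `|d| by rewrite normr_gt0.
  have r1 : 1 <= beta / (1 - beta) by rewrite ler_pdivlMr; lra.
  set r := beta / (1 - beta) in r1.
  have Hn n : n%:R * `|d| <= 2 * M.
    have := iter_avg_sub beta w (fun=> 0) (rcons x a) n m0 b_lt1 Lw.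
    rewrite S_partial0 // subr0 -/d -/r => E.
    have sum_ge : n%:R <= \sum_(0 <= i < n) r ^+ i.+1.
      rewrite -[n in n%:R]subn0 -sumr_const_nat; apply: ler_sum => i _.
      exact: exprn_ege1.
    apply: (@le_trans _ _ `|iter n avg w (rcons x a) - w (rcons x a)|).
      rewrite E normrM ler_wpM2r //; exact: le_trans sum_ge (ler_norm _).
    apply: le_trans (ler_normB _ _) _.
    have := wM (rcons x a).
    have : `|iter n avg w (rcons x a)| <= M by apply: iter_avg_bound.
    lra.
  have M0 : 0 <= 2 * M / `|d|.
    by rewrite divr_ge0 // mulr_ge0 //; apply: le_trans (wM [::]).
  have := Hn (Num.truncn (2 * M / `|d|)).+1; rewrite -ler_pdivlMr //.
  have /andP[_] := truncn_itv M0; lra.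
have wC x : w x = w [::] by elim/last_ind: x => // x a; rewrite wS.
have close (z : nat -> 'I_m) (e : R) : 0 < e -> `|w [::] - psi z| < e.
  move=> e0; have [K HK] := wid e e0.
  rewrite -(wC [seq z i | i <- iota 0 K]); apply: HK; first by rewrite size_map size_iota.
  by rewrite /passes_through size_map size_iota.
have psiC (z : nat -> 'I_m) : psi z = w [::].
  apply/eqP; rewrite eq_sym -subr_eq0 -normr_le0 leNgt; apply/negP => c.
  by have := close z _ c; rewrite ltxx.
have m1 : (m.-1 < m)%N by rewrite prednK.
have /andP[_] := @psi_bounds R m (fun=> Ordinal m0) 2.
have /andP[+ _] := @psi_bounds R m (fun=> Ordinal m1) 1.
rewrite !psiC /psi_series /series /= big_nat1 big1 ?add0r; last first.
  by move=> i _; rewrite mul0r.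
rewrite expr1 => A B; have := le_trans A B.
have mR : 2 <= m%:R :> R by rewrite ler_nat.
have -> : m.-1%:R = m%:R - 1 :> R by rewrite -[in RHS](prednK m0) -natr1 addrK.
rewrite -[X in _ <= X]mul1r ler_pdivlMr ?exprn_gt0 //; last lra.
rewrite expr2 mulrA divfK; last by rewrite gt_eqF //; lra.
nra.
Qed.

Lemma solution_exists {R : realType} {m : nat} (z0 : 'I_m) (beta : R) (h : seq 'I_m -> R)
    (f : R -> R) :
  (2 <= m)%N -> 0 <= beta -> beta < 1 / 2 -> (forall x, S_converges beta h x) ->
  level_sup beta h @ \oo --> (0 : R) -> {within `[0, 1]%classic, continuous f} ->
  exists u, (forall x, Lop beta u x = h x) /\ vanishes (fun x => u x - bval z0 f x).
Proof.
move=> m2 b0 b1 Sc /level_sup_vanishes W0 cf; have m0 : (0 < m)%N by exact: ltnW.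
have /andP[r0 r1] := ratio_lt1 beta b0 b1.
have [F [avgF Ff]] := harmonic_extension z0 f m2 cf.
set S := S_beta beta h in W0; set r := beta / (1 - beta) in r0 r1 W0.
pose G x := F x + S x.
pose c := G [::] - r / (1 - r) * h [::].
pose u x := r ^+ size x * c + (1 - r) * wsum r G x.
have uS x a : u (rcons x a) = r * u x + (1 - r) * G (rcons x a).
  by rewrite /u wsum_rcons size_rcons exprS; ring.
have avg_u x : avg u x = r * u x + (1 - r) * G x - h x / (1 - beta).
  have -> : avg u x = avg (fun y => r * u x + (1 - r) * G y) x.
    by congr (_ * _); apply: eq_bigr => a _; exact: uS.
  rewrite avgD avg_const // avgZ avgD avgF avg_S_beta // -/S /G /r.
  by field; apply/andP; split; lra.
exists u; split => [x|].
  case/lastP: x => [|x a].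
    rewrite LopE avg_u /u wsum_nil expr0 mul1r mulr0 addr0 /c /r.
    by field; apply/andP; split; lra.
  by rewrite Lop_rcons avg_u uS /r; field; lra.
pose e x := u x - F x - (1 - r) * wsum r S x.
have dF : vanishes (fun x => F (pred_node x) - F x).
  move=> eps eps0; have [K1 H1] := Ff (eps / 3) ltac:(lra).
  have [K2 H2] := bval_oscillation z0 f m2 cf (eps / 3) ltac:(lra).
  exists (maxn K1 K2).+1; case/lastP => [//|x a].
  rewrite size_rcons pred_node_rcons ltnS geq_max => /andP[k1 k2].
  have a1 := H1 x k1; have a2 := H1 (rcons x a) ltac:(rewrite size_rcons; exact: leqW).
  have := H2 x [:: a] k2; rewrite cats1.
  move: a1 a2; rewrite !ler_norml => /andP[? ?] /andP[? ?] /andP[? ?].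
  by apply/andP; split; lra.
have e0 : vanishes e.
  apply: (@vanishes_contraction R m r e _ r0 r1 (vanishesZ r _ dF)) => x a.
  rewrite pred_node_rcons -{1}(ger0_norm r0) -normrM; apply: le_trans (ler_normD _ _).
  rewrite le_eqVlt; apply/orP; left; apply/eqP; congr `|_|.
  by rewrite /e uS wsum_rcons /G; ring.
have := vanishesD _ _ (vanishesD _ _ e0 (vanishesZ (1 - r) _ W0)) Ff.
by congr vanishes; apply/funext => x; rewrite /e; ring.
Qed.

Theorem theorem1p2 (R : realType) (m : nat) (hm : (2 <= m)%N) (beta : R)
  (hb0 : 0 <= beta) (hb1 : beta <= 1) (h : seq 'I_m -> R) :
  (forall f : R -> R, {within `[0, 1]%classic, continuous f} ->
     exists u : seq 'I_m -> R,
       (tree_bounded u /\ (forall x, Lop beta u x = h x) /\ boundary_value u f) /\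
       (forall v : seq 'I_m -> R,
          tree_bounded v /\ (forall x, Lop beta v x = h x) /\ boundary_value v f ->
          v = u))
  <->
  (beta < 1 / 2 /\ (forall x : seq 'I_m, S_converges beta h x) /\
   level_sup beta h @ \oo --> (0 : R)).
Proof.
have m0 : (0 < m)%N by exact: ltnW.
pose z0 := Ordinal m0.
split=> [ex|[b1 [Sc W0]] f cf].
  have [u0 [[[M0 u0M] [Lu0 bu0]] _]] := ex (fun=> 0) (fun x => cvg_cst _).
  have [u1 [[[M1 u1M] [Lu1 bu1]] _]] := ex id
    (continuous_subspaceT (fun x => @cvg_id _ (nbhs x))).
  have b1 : beta < 1 / 2.
    apply: (@beta_lt_half R m beta (fun x => u1 x - u0 x)) => // [x||e e0].
    - by rewrite LopB Lu0 Lu1 subrr.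
    - exists (M1 + M0) => x; apply: le_trans (ler_normB _ _) _; exact: lerD.
    have [K0 H0] := bu0 (e / 2) ltac:(lra); have [K1 H1] := bu1 (e / 2) ltac:(lra).
    exists (maxn K0 K1) => x; rewrite geq_max => /andP[k0 k1] z zx.
    have := H0 x k0 z zx; have := H1 x k1 z zx; rewrite !ltr_norml.
    by move=> /andP[? ?] /andP[? ?]; apply/andP; split; lra.
  split=> //; apply: (S_conditions_of_vanishing_solution beta u0) => //.
  have := boundary_value_vanishes z0 _ _ bu0.
  by congr vanishes; apply/funext => x; rewrite subr0.
have [u [Lu uf]] := solution_exists z0 beta h f hm hb0 b1 Sc W0 cf.
exists u; split.
  split; first exact: (vanishes_bounded z0 u f).
  by split=> //; exact: (vanishes_boundary_value z0).
move=> v [_ [Lv bv]]; apply/funext => x; apply/eqP; rewrite -subr_eq0; apply/eqP.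
apply: (Lop_eq0_vanishing beta (fun x => v x - u x)) => // [y|]; first by rewrite LopB Lv Lu subrr.
have := vanishesD _ _ (boundary_value_vanishes z0 _ _ bv) (vanishesZ (-1) _ uf).
by congr vanishes; apply/funext => y; ring.
Qed.
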